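(* Let $A=\mathbb Q[\lambda,(1-\lambda)^{-1}]$ be the localization of $\mathbb Q[\lambda]$ at $1-\lambda$, and let $M_\lambda:A\to A$ be multiplication by $\frac{\lambda}{1-\lambda}$. Let $\Psi$ be the $A$-valued invariant of labeled posets defined recursively by $\Psi(\emptyset)=\frac1{1-\lambda}$ and, for every non-empty labeled poset $(P,\omega)$, $$\Psi(P,\omega)=M_\lambda\sum_{\emptyset\ne S\in\mathcal I_\omega(P)}\Psi(P\setminus S,\omega).$$ Then $\Psi(P,\omega)=\tilde e(P,\omega;\lambda)$ for every labeled poset $(P,\omega)$.
   Context: All posets are finite and $\mathbb N^+=\{1,2,\dots\}$, $[n]=\{1,\dots,n\}$. An ideal of a poset $P$ is a down-closed subset (including $\emptyset$ and $P$). A labeled poset $(P,\omega)$ is a finite poset $P$ with an injective map $\omega:P\to\mathbb N^+$; each subset $S\subseteq P$ carries the induced order and labeling, giving a labeled poset $(S,\omega)$. A subset $S$ is $\omega$-natural if $\omega|_S$ is order-preserving; $\mathcal I_\omega(P)$ is the set of ideals of $P$ that are $\omega$-natural. A map $f:P\to[n]$ is $\omega$-order-preserving if it is order-preserving and $f(x)>f(y)$ whenever $x>y$ in $P$ and $\omega(x)<\omega(y)$. The order polynomial $\Omega(P,\omega;t)$ is the unique polynomial in $t$ whose value at each $n\in\mathbb N^+$ is the number of $\omega$-order-preserving maps $P\to[n]$; $\Omega(\emptyset,\omega;t)=1$. The Eulerian polynomial $e(P,\omega;\lambda)$ and the invariant $\tilde e(P,\omega;\lambda)$ are defined by $$\tilde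 e(P,\omega;\lambda)=\sum_{n=0}^\infty\Omega(P,\omega;n)\lambda^n=\frac{e(P,\omega;\lambda)}{(1-\lambda)^{|P|+1}} ,$$ where $e(P,\omega;\lambda)$ is a polynomial in $\lambda$, so $\tilde e(P,\omega;\lambda)$ is regarded as an element of $\mathbb Q[\lambda,(1-\lambda)^{-1}]$. *)

(* Defs.v *)
From HB Require Import structures.
From mathcomp Require Import all_boot all_order all_algebra.
From mathcomp Require Import boolp.
From mathcomp Require classical_sets.

Set Implicit Arguments.
Unset Strict Implicit.
Unset Printing Implicit Defensive.

Import Order.TTheory GRing.Theory Num.Theory.
Local Open Scope ring_scope.

(* The localization A = Q[lambda, (1 - lambda)^-1], as a subring of the field
   Q(lambda) of rational functions; lambda is the polynomial variable 'X. *)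
Definition localization : {pred {fraction {poly rat}}} :=
  fun x => `[< exists (p : {poly rat}) (k : nat),
                 x = tofrac p / tofrac (1 - 'X) ^+ k >].

Lemma sub1X_neq0 : (1 - 'X : {poly rat}) != 0.
Proof.
apply/eqP => /(congr1 (fun p : {poly rat} => p.[0])).
by rewrite hornerD hornerN hornerX !hornerC subr0 => /eqP; rewrite oner_eq0.
Qed.

Lemma tofrac_sub1X_neq0 : tofrac (1 - 'X : {poly rat}) != 0.
Proof. by rewrite tofrac_eq0 sub1X_neq0. Qed.

Lemma localization_subring_closed : subring_closed localization.
Proof.
split=> [|x y|x y].
- by apply/asboolP; exists 1, 0; rewrite expr0 divr1 tofrac1.
- move=> /asboolP[p [k ->]] /asboolP[q [l ->]]; apply/asboolP.
  exists (p * (1 - 'X) ^+ l - q * (1 - 'X) ^+ k), (k + l)%N.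
  have nz n : tofrac (1 - 'X : {poly rat}) ^+ n != 0.
    by rewrite expf_neq0 ?tofrac_sub1X_neq0.
  by rewrite (tofracB (p * _)) !tofracM !tofracXn exprD -mulNr addf_div ?mulNr.
- move=> /asboolP[p [k ->]] /asboolP[q [l ->]]; apply/asboolP.
  by exists (p * q), (k + l)%N; rewrite tofracM exprD mulf_div.
Qed.

HB.instance Definition _ := GRing.isSubringClosed.Build _ localization
  localization_subring_closed.

Record Alambda := MkAlambda {
  Aval :> {fraction {poly rat}};
  AvalP : Aval \in localization }.

HB.instance Definition _ := [isSub for Aval].
HB.instance Definition _ := [Choice of Alambda by <:].
HB.instance Definition _ := [SubChoice_isSubComNzRing of Alambda by <:].

Lemma locfrac_subproof (p : {poly rat}) (k : nat) :
  tofrac p / tofrac (1 - 'X) ^+ k \in localization.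
Proof. by apply/asboolP; exists p, k. Qed.

(* The element p / (1 - lambda)^k of A. *)
Definition locfrac (p : {poly rat}) (k : nat) : Alambda :=
  MkAlambda (locfrac_subproof p k).

Definition M_lambda (a : Alambda) : Alambda := locfrac 'X 1 * a.

Record lposet (d : Order.disp_t) := LPoset {
  lp_sort :> finPOrderType d;
  label : lp_sort -> nat;
  label_inj : injective label;
  label_gt0 : forall x, (0 < label x)%N }.

Section InducedOrder.
Variables (d : Order.disp_t) (T : finPOrderType d) (S : {set T}).
Definition induced_sort := {x : T | x \in S}.
HB.instance Definition _ := SubFinite.on induced_sort.
HB.instance Definition _ :=
  [SubChoice_isSubPOrder of induced_sort by <: with d].
End InducedOrder.

Section LabeledPosets.
Variable d : Order.disp_t.
Implicit Type P : lposet d.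

Section Induced.
Variables (P : lposet d) (S : {set P}).
Let ilabel (x : induced_sort S) : nat := label (val x).
Fact ilabel_inj : injective ilabel.
Proof. by move=> x y /label_inj /val_inj. Qed.
Fact ilabel_gt0 x : (0 < ilabel x)%N. Proof. exact: label_gt0. Qed.
Definition induced : lposet d := LPoset ilabel_inj ilabel_gt0.
End Induced.

Definition is_ideal P (S : {set P}) : bool :=
  [forall x in S, forall y : P, (y <= x)%O ==> (y \in S)].

Definition is_natural P (S : {set P}) : bool :=
  [forall x in S, forall y in S, (x <= y)%O ==> (label x <= label y)%N].

Definition natural_ideals P : {set {set P}} :=
  [set S | is_ideal S && is_natural S].

(* Only the order of the codomain matters, so [n] = {1, ..., n} is represented
   by 'I_n = {0, ..., n - 1}. *)
Definition omega_preserving P n (f : {ffun P -> 'I_n}) : bool :=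
  [forall x : P, forall y : P,
     ((x <= y)%O ==> (f x <= f y)%N) &&
     ((y < x)%O && (label x < label y)%N ==> (f y < f x)%N)].

Definition is_order_poly P (p : {poly rat}) : Prop :=
  forall n : nat, (0 < n)%N ->
    p.[n%:R] = #|[set f : {ffun P -> 'I_n} | omega_preserving f]|%:R.

Lemma order_poly_unique P (p q : {poly rat}) :
  is_order_poly P p -> is_order_poly P q -> p = q.
Proof.
move=> hp hq; apply/eqP; rewrite -subr_eq0; apply/negPn/negP => nz.
pose s := [seq i.+1%:R : rat | i <- iota 0 (size (p - q))].
have us : uniq s.
  by rewrite map_inj_uniq ?iota_uniq // => i j /eqP; rewrite eqr_nat => /eqP[].
have rs : all (root (p - q)) s.
  by apply/allP => _ /mapP[i _ ->]; rewrite /root hornerD hornerN hp ?hq ?subrr.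
by have := max_poly_roots nz rs us; rewrite size_map size_iota ltnn.
Qed.

(* The polynomial satisfying [is_order_poly]. One always exists, by the
   standard theory of (P, omega)-partitions, so the default 0 is not reached. *)
Definition order_poly P : {poly rat} :=
  classical_sets.xget 0 (is_order_poly P).

(* (1 - lambda)^(#|P| + 1) * \sum_n Omega(P; n) lambda^n = e as formal power
   series in lambda, compared coefficient by coefficient (Cauchy product). *)
Definition is_eulerian_poly P (e : {poly rat}) : Prop :=
  forall n : nat,
    \sum_(i < n.+1) ((1 - 'X) ^+ #|P|.+1 : {poly rat})`_i
                    * (order_poly P).[(n - i)%N%:R]
    = e`_n.

Lemma eulerian_poly_unique P (e e' : {poly rat}) :
  is_eulerian_poly P e -> is_eulerian_poly P e' -> e = e'.
Proof. by move=> he he'; apply/polyP => n; rewrite -he -he'. Qed.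

(* The polynomial satisfying [is_eulerian_poly]. One always exists, since
   Omega(P; t) has degree at most #|P|, so the default 0 is not reached. *)
Definition eulerian_poly P : {poly rat} :=
  classical_sets.xget 0 (is_eulerian_poly P).

Definition etilde P : Alambda := locfrac (eulerian_poly P) #|P|.+1.

(* The recursion for Psi, made structural by a bound n on #|P|. *)
Fixpoint psi_rec (n : nat) P : Alambda :=
  if n is n'.+1 then
    if #|P| == 0%N then locfrac 1 1
    else M_lambda
      (\sum_(S in natural_ideals P | S != set0) psi_rec n' (induced (~: S)))
  else locfrac 1 1.

Definition psi P : Alambda := psi_rec #|P| P.

Lemma card_induced P (S : {set P}) : #|induced S| = #|S|.
Proof. by rewrite card_sig; apply: eq_card => x; rewrite inE. Qed.

Lemma card_inducedC_lt P (S : {set P}) : S != set0 -> (#|induced (~: S)| < #|P|)%N.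
Proof.
rewrite -card_gt0 => S_gt0.
by rewrite card_induced -(cardsC S) -addn1 addnC leq_add2r.
Qed.

Lemma psi_rec_card n P : (#|P| <= n)%N -> psi_rec n P = psi P.
Proof.
rewrite /psi; have [m] := ubnP n; elim: m => // m IH in n P *; rewrite ltnS => nm.
case: n nm => [_|n nm le_n]; first by rewrite leqn0 => /eqP ->.
case E: #|P| => [|k] /=; first by rewrite E.
rewrite E /=; congr M_lambda; apply: eq_bigr => S /andP[_ S0].
have lt : (#|induced (~: S)| <= k)%N by rewrite -ltnS -E card_inducedC_lt.
have lt_kn : (k <= n)%N by rewrite -ltnS -E.
rewrite [LHS]IH ?[RHS]IH // ?(leq_trans lt) //.
exact: leq_ltn_trans lt_kn nm.
Qed.

Lemma psi_empty P : #|P| = 0%N -> psi P = locfrac 1 1.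
Proof. by rewrite /psi => ->. Qed.

Lemma psi_nonempty P : (0 < #|P|)%N ->
  psi P = M_lambda
    (\sum_(S in natural_ideals P | S != set0) psi (induced (~: S))).
Proof.
rewrite {1}/psi; case E: #|P| => [//|k] _ /=; rewrite E /=; congr M_lambda.
apply: eq_bigr => S /andP[_ S0]; apply: psi_rec_card.
by rewrite -ltnS -E card_inducedC_lt.
Qed.

End LabeledPosets.

(* Main.v *)
(** The fiber of an omega-order-preserving map P -> [n+1] over the least element is
   an omega-natural ideal S (possibly empty), and the map is determined by S and by
   its restriction to P \ S, an arbitrary omega-order-preserving map to [n].
   Writing N(P, n) for the number of maps to [n], this gives
     N(P, n+1) - N(P, n) = \sum_(S != set0) N(P \ S, n).
   By Faulhaber, N(P, n) is therefore polynomial in n, including at n = 0 where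
   N(P, 0) = 0 for nonempty P; and the generating series F_P satisfies
     (1 - lambda) F_P = lambda \sum_(S != set0) F_(P \ S),
   which is the recursion of Psi. Power series are handled as polynomials
   truncated at degree N, compared modulo 'X^N for every N. *)

Require Import Defs.
From HB Require Import structures.
From mathcomp Require Import all_boot all_order all_algebra.
From mathcomp Require Import boolp.
From mathcomp Require classical_sets.
From mathcomp Require Import ring.

Set Implicit Arguments.
Unset Strict Implicit.
Unset Printing Implicit Defensive.

Import Order.TTheory GRing.Theory Num.Theory.
Local Open Scope ring_scope.

(** * Polynomial sequences and power sums *)

Definition polynomial_seq (f : nat -> rat) : Prop :=
  exists p : {poly rat}, forall n, f n = p.[n%:R].

Lemma polynomial_seqD f g : polynomial_seq f -> polynomial_seq g ->
  polynomial_seq (fun n => f n + g n).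
Proof. by move=> [p hp] [q hq]; exists (p + q) => n; rewrite hornerD hp hq. Qed.

Lemma polynomial_seqZ c f : polynomial_seq f ->
  polynomial_seq (fun n => c * f n).
Proof. by move=> [p hp]; exists (c *: p) => n; rewrite hornerZ hp. Qed.

Lemma polynomial_seq_sum (I : Type) (r : seq I) (Q : pred I) (F : I -> nat -> rat) :
  (forall i, Q i -> polynomial_seq (F i)) ->
  polynomial_seq (fun n => \sum_(i <- r | Q i) F i n).
Proof.
move=> hF; elim: r => [|i r [p hp]].
  by exists 0 => n; rewrite big_nil horner0.
case Qi: (Q i); last by exists p => n; rewrite big_cons Qi.
by have [q hq] := hF i Qi; exists (q + p) => n; rewrite big_cons Qi hornerD hp hq.
Qed.

(** Telescoping of $(i+1)^{m+1} - i^{m+1}$ over $i < n$, expanded by the binomial theorem. With the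
    top power isolated, strong induction on [m] applies. *)
Lemma power_sum_rec m n :
  m.+1%:R * \sum_(i < n) i%:R ^+ m =
    n%:R ^+ m.+1 - \sum_(j < m) 'C(m.+1, j)%:R * \sum_(i < n) i%:R ^+ j :> rat.
Proof.
elim: n => [|n IH].
  rewrite big_ord0 mulr0 expr0n /= big1 ?subr0 // => j _.
  by rewrite big_ord0 mulr0.
rewrite big_ord_recr /= mulrDr IH.
under [in RHS]eq_bigr do rewrite big_ord_recr /= mulrDr.
(* The terms of degree [m] and [m.+1] are split off the binomial expansion; the remaining ones match
   the sum over [j < m]. *)
rewrite big_split /= -[n.+1]addn1 natrD exprD1n 2!big_ord_recr /=.
rewrite binn binSn; under [X in _ = X + _ + _ - _]eq_bigr do rewrite -mulr_natl.
rewrite -(mulr_natl _ m.+1).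
ring.
Qed.

Lemma polynomial_seq_power_sum m :
  polynomial_seq (fun n => \sum_(i < n) i%:R ^+ m).
Proof.
have [k] := ubnP m; elim: k m => // k IH m; rewrite ltnS => le_mk.
have [p hp] : polynomial_seq (fun n => m.+1%:R^-1 * (n%:R ^+ m.+1 + -1 *
    \sum_(j < m) 'C(m.+1, j)%:R * \sum_(i < n) i%:R ^+ j)).
  apply/polynomial_seqZ/polynomial_seqD.
    by exists ('X^(m.+1)) => n; rewrite hornerXn.
  apply/polynomial_seqZ/polynomial_seq_sum => j _.
  by apply/polynomial_seqZ/IH/(leq_trans _ le_mk).
exists p => n; rewrite -hp mulN1r -power_sum_rec mulKf //.
by rewrite pnatr_eq0.
Qed.

(** By linearity it suffices to sum monomials: the sums over [i] and over the coefficients of [p]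
    are exchanged. *)
Lemma polynomial_seq_partial_sum f :
  polynomial_seq f -> polynomial_seq (fun n => \sum_(i < n) f i).
Proof.
move=> [p hp].
have [q hq] : polynomial_seq
    (fun n => \sum_(j < size p) p`_j * \sum_(i < n) i%:R ^+ j).
  by apply: polynomial_seq_sum => j _; apply/polynomial_seqZ/polynomial_seq_power_sum.
exists q => n; rewrite -hq; under [RHS]eq_bigr do rewrite mulr_sumr.
by rewrite exchange_big; apply: eq_bigr => i _; rewrite hp horner_coef.
Qed.

(** * Congruence modulo powers of the variable, and sums of fractions in A *)

Lemma dvdXnP (F : fieldType) N (p : {poly F}) :
  reflect (forall i, (i < N)%N -> p`_i = 0) ('X^N %| p).
Proof.
apply: (iffP (dvdpP _ _)) => [[q -> i lt_iN]|p0]; first by rewrite coefMXn lt_iN.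
exists (drop_poly N p); rewrite -[LHS](poly_take_drop N) -[RHS]add0r; congr (_ + _).
by apply/polyP => i; rewrite coef_take_poly coef0; case: ifP => // /p0.
Qed.

(** The summands are brought over $(1-\lambda)^m$; [M_lambda] contributes the factor ['X] and one
    more power of the denominator. *)
Lemma M_lambda_sum_locfrac (I : finType) (Q : pred I) (e : I -> {poly rat})
    (k : I -> nat) m : (forall i, Q i -> (k i <= m)%N) ->
  M_lambda (\sum_(i | Q i) locfrac (e i) (k i)) =
  locfrac ('X * \sum_(i | Q i) (1 - 'X) ^+ (m - k i) * e i) m.+1.
Proof.
move=> km; apply: val_inj.
rewrite rmorphM raddf_sum /= expr1 tofracM raddf_sum /= exprS invfM mulrACA.
congr (_ * _); rewrite mulr_suml; apply: eq_bigr => i Qi.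
have u n : tofrac (1 - 'X : {poly rat}) ^+ n != 0.
  by rewrite expf_neq0 ?tofrac_sub1X_neq0.
rewrite tofracM tofracXn -{2}(subnK (km i Qi)) exprD.
by rewrite invfM mulrACA mulfV // mul1r.
Qed.

(** * Order-preserving maps and natural ideals *)

Section Counting.
Variable d : Order.disp_t.
Implicit Type P : lposet d.

Definition count_preserving P n :=
  #|[set f : {ffun P -> 'I_n} | omega_preserving f]|.

Lemma omega_preservingP P n (f : {ffun P -> 'I_n}) :
  reflect ((forall x y, (x <= y)%O -> (f x <= f y)%N) /\
           (forall x y, (y < x)%O -> (label x < label y)%N -> (f y < f x)%N))
          (omega_preserving f).
Proof.
apply: (iffP forallP) => [h|[h1 h2] x]; first split=> x y.
- by have /forallP/(_ y)/andP[/implyP] := h x.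
- move=> yx lxy; have /forallP/(_ y)/andP[_ /implyP] := h x.
  by apply; rewrite yx.
- apply/forallP => y; apply/andP; split; apply/implyP; first exact: h1.
  by case/andP; apply: h2.
Qed.

Lemma is_idealP P (S : {set P}) :
  reflect (forall x y, x \in S -> (y <= x)%O -> y \in S) (is_ideal S).
Proof.
apply: (iffP forall_inP) => [h x y xS yx|h x xS].
  by have /forallP/(_ y)/implyP := h x xS; apply.
by apply/forallP => y; apply/implyP; apply: h.
Qed.

Lemma is_naturalP P (S : {set P}) :
  reflect (forall x y, x \in S -> y \in S -> (x <= y)%O -> (label x <= label y)%N)
          (is_natural S).
Proof.
apply: (iffP forall_inP) => [h x y xS yS|h x xS].
  by have /forall_inP/(_ y yS)/implyP := h x xS.
by apply/forall_inP => y yS; apply/implyP; apply: h.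
Qed.

(** * Maps with a prescribed fiber over the least element *)

Section ExtendByZero.
Variables (P : lposet d) (S : {set P}) (n : nat).

Definition zero_set (f : {ffun P -> 'I_n.+1}) : {set P} :=
  [set x | f x == ord0].

(** Inverse of restriction to the complement of the fiber: [lift ord0] shifts values up by one,
    freeing [ord0] for [S]. *)
Definition extend_by_zero (g : {ffun induced (~: S) -> 'I_n}) :
    {ffun P -> 'I_n.+1} :=
  [ffun x => if insub x : option (induced_sort (~: S)) is Some u
             then lift ord0 (g u) else ord0].

Lemma extend_by_zero_val g (u : induced (~: S)) :
  extend_by_zero g (val (u : induced_sort (~: S))) = lift ord0 (g u).
Proof. by rewrite ffunE valK. Qed.

Lemma extend_by_zero_in g x : x \in S -> extend_by_zero g x = ord0.
Proof. by move=> xS; rewrite ffunE insubN // inE negbK. Qed.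

Lemma extend_by_zero_inj : injective extend_by_zero.
Proof.
move=> g h /ffunP gh; apply/ffunP => u.
by apply: (@lift_inj _ ord0); rewrite -!extend_by_zero_val.
Qed.

Lemma zero_set_extend g : zero_set (extend_by_zero g) = S.
Proof.
apply/setP => x; rewrite inE; have [xS|xS] := boolP (x \in S).
  by rewrite extend_by_zero_in ?eqxx.
have xS' : x \in ~: S by rewrite inE.
by rewrite (extend_by_zero_val g (Sub x xS' : induced_sort (~: S))).
Qed.

Lemma extend_by_zero_surj f : zero_set f = S -> exists g, f = extend_by_zero g.
Proof.
move=> fS; have f0 x : (f x == ord0) = (x \in S) by rewrite -fS inE.
have nz (u : induced (~: S)) : ord0 != f (val (u : induced_sort (~: S))).
  by have := valP (u : induced_sort (~: S)); rewrite inE eq_sym f0.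
exists [ffun u => s2val (unlift_some (nz u))]; apply/ffunP => x.
have [xS|xS] := boolP (x \in S).
  by rewrite extend_by_zero_in //; apply/eqP; rewrite f0.
have xS' : x \in ~: S by rewrite inE.
rewrite (extend_by_zero_val _ (Sub x xS' : induced_sort (~: S))) ffunE.
by case: unlift_some.
Qed.

Hypothesis S_natural_ideal : S \in natural_ideals P.

Lemma omega_preserving_extend g :
  omega_preserving (extend_by_zero g) = omega_preserving g.
Proof.
have /andP[/is_idealP idS /is_naturalP natS] :
  is_ideal S && is_natural S by move: S_natural_ideal; rewrite inE.
apply/omega_preservingP/omega_preservingP => -[h1 h2]; split=> x y.
- by move=> /h1; rewrite !extend_by_zero_val.
- by move=> yx lxy; have := h2 (val x) (val y) yx lxy; rewrite !extend_by_zero_val.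
- move=> xy; have [xS|xS] := boolP (x \in S).
    by rewrite (extend_by_zero_in _ xS).
  have yS : y \notin S by apply: contra xS => yS; apply: idS xy.
  have xS' : x \in ~: S by rewrite inE.
  have yS' : y \in ~: S by rewrite inE.
  rewrite (extend_by_zero_val g (Sub x xS' : induced_sort (~: S))).
  rewrite (extend_by_zero_val g (Sub y yS' : induced_sort (~: S))).
  exact: h1.
- move=> yx lxy; have [xS|xS] := boolP (x \in S).
    (* A label descent cannot end in [S]: the ideal would contain [y] too, against naturality. *)
    have yS := idS _ _ xS (ltW yx).
    by have := natS _ _ yS xS (ltW yx); rewrite leqNgt lxy.
  have xS' : x \in ~: S by rewrite inE.
  rewrite (extend_by_zero_val g (Sub x xS' : induced_sort (~: S))).
  have [yS|yS] := boolP (y \in S); first by rewrite extend_by_zero_in.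
  have yS' : y \in ~: S by rewrite inE.
  rewrite (extend_by_zero_val g (Sub y yS' : induced_sort (~: S))).
  exact: (h2 (Sub x xS' : induced_sort (~: S)) (Sub y yS' : induced_sort (~: S))).
Qed.

Lemma card_preserving_zero_set :
  #|[set f : {ffun P -> 'I_n.+1} | omega_preserving f & zero_set f == S]| =
  count_preserving (induced (~: S)) n.
Proof.
rewrite /count_preserving -(card_imset _ extend_by_zero_inj).
apply: eq_card => f; rewrite inE; apply/andP/imsetP => [[pf /eqP/extend_by_zero_surj]|].
  by case=> g fg; exists g; rewrite // inE -omega_preserving_extend -fg.
by case=> g; rewrite inE => pg ->; rewrite omega_preserving_extend zero_set_extend.
Qed.

End ExtendByZero.

(** Nothing lies below the least value, and a label descent inside the fiber would force a strict
    inequality between equal values. *)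
Lemma zero_set_natural_ideal P n (f : {ffun P -> 'I_n.+1}) :
  omega_preserving f -> zero_set f \in natural_ideals P.
Proof.
move=> /omega_preservingP[h1 h2]; rewrite inE; apply/andP; split.
  apply/is_idealP => x y; rewrite !inE => /eqP fx /h1.
  by rewrite fx leqn0 => fy; apply/eqP/val_inj/eqP.
apply/is_naturalP => x y; rewrite !inE => /eqP fx /eqP fy.
rewrite le_eqVlt => /orP[/eqP->//|xy]; rewrite leqNgt; apply/negP => lyx.
by have := h2 y x xy lyx; rewrite fx fy.
Qed.

(** * Recursion and polynomiality of the counts *)

Lemma count_preservingS P n :
  count_preserving P n.+1 =
  (\sum_(S in natural_ideals P) count_preserving (induced (~: S)) n)%N.
Proof.
rewrite {1}/count_preserving -sum1_card.
rewrite (partition_big (@zero_set P n) (mem (natural_ideals P))) /=; last first.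
  by move=> f; rewrite inE; apply: zero_set_natural_ideal.
apply: eq_bigr => S hS; rewrite -(card_preserving_zero_set _ hS) -sum1_card.
by apply: eq_bigl => f; rewrite !inE.
Qed.

Lemma set0_natural_ideal P : set0 \in natural_ideals P.
Proof.
by rewrite inE; apply/andP; split; [apply/is_idealP|apply/is_naturalP] => x y; rewrite inE.
Qed.

(* [induced (~: set0)] is isomorphic but not equal to [P]. *)
Lemma count_preserving_inducedT P n :
  count_preserving (induced (~: set0 : {set P})) n = count_preserving P n.
Proof.
pose h (f : {ffun P -> 'I_n}) : {ffun induced (~: set0 : {set P}) -> 'I_n} :=
  [ffun u => f (val (u : induced_sort _))].
have inP x : x \in (~: set0 : {set P}) by rewrite !inE.
have h_inj : injective h.
  move=> f g /ffunP fg; apply/ffunP => x.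
  by have := fg (Sub x (inP x) : induced_sort _); rewrite !ffunE.
rewrite /count_preserving -(card_imset _ h_inj); apply: eq_card => g.
rewrite inE; apply/omega_preservingP/imsetP => [[h1 h2]|].
  pose f := [ffun x : P => g (Sub x (inP x) : induced_sort _)].
  exists f; last first.
    by apply/ffunP => u; rewrite !ffunE; congr (g _); apply: val_inj.
  rewrite inE; apply/omega_preservingP; split=> x y; rewrite !ffunE.
    by move=> xy; apply: h1.
  by move=> yx lxy; apply: h2.
case=> f; rewrite inE => /omega_preservingP[h1 h2] ->; split=> x y; rewrite !ffunE.
  by move=> xy; apply: h1.
by move=> yx lxy; apply: h2.
Qed.

Lemma count_preserving_diff P n :
  count_preserving P n.+1 = (count_preserving P n +
  \sum_(S in natural_ideals P | S != set0) count_preserving (induced (~: S)) n)%N.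
Proof.
rewrite count_preservingS (bigD1 set0) ?set0_natural_ideal //=.
by rewrite count_preserving_inducedT.
Qed.

(** Preservation is vacuous over an empty codomain, so the count is $0^{|P|}$ with $0^0 = 1$. *)
Lemma count_preserving0 P : count_preserving P 0 = (#|P| == 0)%N.
Proof.
have -> : count_preserving P 0 = #|{ffun P -> 'I_0}|.
  rewrite -cardsT; apply: eq_card => f; rewrite !inE.
  by apply/forallP => x; case: (f x).
by rewrite card_ffun card_ord; case: #|_| => // n; rewrite exp0n.
Qed.

Lemma set_of_empty P (S : {set P}) : #|P| = 0%N -> S = set0.
Proof.
move=> P0; apply/eqP; rewrite -cards_eq0 -leqn0 -P0; exact: max_card.
Qed.

Lemma count_preserving_sum P n :
  count_preserving P n = (count_preserving P 0 +
  \sum_(i < n) \sum_(S in natural_ideals P | S != set0)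
    count_preserving (induced (~: S)) i)%N.
Proof.
elim: n => [|n IH]; first by rewrite big_ord0 addn0.
by rewrite count_preserving_diff IH big_ord_recr addnA.
Qed.

(** Strong induction on [#|P|]: every nonempty [S] leaves a smaller poset, and partial sums preserve
    polynomiality. *)
Lemma polynomial_seq_count_preserving P :
  polynomial_seq (fun n => (count_preserving P n)%:R).
Proof.
have [k] := ubnP #|P|; elim: k P => // k IH P; rewrite ltnS => le_Pk.
have [p hp] : polynomial_seq (fun n => (count_preserving P 0)%:R +
    \sum_(i < n) \sum_(S in natural_ideals P | S != set0)
      (count_preserving (induced (~: S)) i)%:R).
  apply: polynomial_seqD.
    by exists (count_preserving P 0)%:R%:P => n; rewrite hornerC.
  apply: (polynomial_seq_partial_sum (f := fun i =>
    \sum_(S in natural_ideals P | S != set0)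
      (count_preserving (induced (~: S)) i)%:R)).
  apply: polynomial_seq_sum => S /andP[_ S0].
  by apply: IH; apply: leq_trans le_Pk; apply: card_inducedC_lt.
exists p => n; rewrite -hp count_preserving_sum natrD natr_sum.
by under eq_bigr do rewrite natr_sum.
Qed.

(** [is_order_poly] constrains positive arguments only; the value at 0 is right because the
    polynomial found above also fits there. *)
Lemma order_polyE P n : (order_poly P).[n%:R] = (count_preserving P n)%:R.
Proof.
have [p hp] := polynomial_seq_count_preserving P.
have op : is_order_poly P p by move=> m _; rewrite -hp.
rewrite hp; congr (_.[_]).
by apply: (order_poly_unique _ op); apply: classical_sets.xgetPex; exists p.
Qed.

(** * Truncated generating series and Eulerian polynomials *)

Definition truncated_series P N : {poly rat} :=
  \poly_(i < N) (count_preserving P i)%:R.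

(** Coefficient [n] of the product involves only series coefficients up to [n], so every truncation
    at [N > n] determines it. *)
Lemma is_eulerian_polyP P e :
  is_eulerian_poly P e <->
  forall N, 'X^N %| (1 - 'X) ^+ #|P|.+1 * truncated_series P N - e.
Proof.
have E n N : (n < N)%N -> ((1 - 'X) ^+ #|P|.+1 * truncated_series P N)`_n =
    \sum_(i < n.+1) ((1 - 'X) ^+ #|P|.+1 : {poly rat})`_i
                    * (order_poly P).[(n - i)%N%:R].
  move=> lt_nN; rewrite coefM; apply: eq_bigr => i _.
  by rewrite coef_poly (leq_ltn_trans (leq_subr _ _)) // order_polyE.
split=> [he N|he n].
  by apply/dvdXnP => i lt_iN; rewrite coefB E // he subrr.
have /dvdXnP/(_ n (ltnSn n)) := he n.+1.
by rewrite coefB E // => /eqP; rewrite subr_eq0 => /eqP.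
Qed.

Lemma truncated_series_diff P N : (0 < #|P|)%N ->
  'X^N %| (1 - 'X) * truncated_series P N -
    'X * \sum_(S in natural_ideals P | S != set0)
           truncated_series (induced (~: S)) N.
Proof.
move=> P_gt0; apply/dvdXnP => -[|i] lt_iN.
  (* The constant coefficient vanishes since a nonempty poset has no map to the empty chain;
     coefficient [i.+1] is the difference equation at [i]. *)
  rewrite mulrBl mul1r !coefB !coefXM coef_poly lt_iN !subr0 count_preserving0.
  by case: #|P| P_gt0.
rewrite mulrBl mul1r !coefB !coefXM /= coef_sum !coef_poly lt_iN (ltnW lt_iN).
rewrite count_preserving_diff natrD natr_sum.
apply/eqP; rewrite subr_eq0 addrC addKr; apply/eqP/eq_bigr => S _.
by rewrite coef_poly (ltnW lt_iN).
Qed.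

Lemma is_eulerian_poly_empty P : #|P| = 0%N -> is_eulerian_poly P 1.
Proof.
move=> P0; apply/is_eulerian_polyP => N; apply/dvdXnP => i lt_iN.
have E n : count_preserving P n = 1%N.
  rewrite count_preserving_sum count_preserving0 P0 big1 // => j _.
  by rewrite big1 // => S /andP[_]; rewrite [S]set_of_empty ?eqxx.
rewrite P0 expr1 mulrBl mul1r !coefB coefXM coef1 !coef_poly lt_iN.
case: i lt_iN => [|i] lt_iN /=; first by rewrite E; ring.
by rewrite (ltnW lt_iN) !E; ring.
Qed.

Lemma is_eulerian_poly_rec P (e : {set P} -> {poly rat}) : (0 < #|P|)%N ->
  (forall S, S != set0 -> is_eulerian_poly (induced (~: S)) (e S)) ->
  is_eulerian_poly P
    ('X * \sum_(S in natural_ideals P | S != set0) (1 - 'X) ^+ #|S|.-1 * e S).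
Proof.
move=> P_gt0 he; apply/is_eulerian_polyP => N.
pose t (S : {set P}) := truncated_series (induced (~: S)) N.
(* The error splits into a multiple of the error in the difference relation and multiples of the
   errors for the smaller posets, all divisible by ['X^N]. *)
have -> : (1 - 'X) ^+ #|P|.+1 * truncated_series P N -
    'X * \sum_(S in natural_ideals P | S != set0) (1 - 'X) ^+ #|S|.-1 * e S =
  (1 - 'X) ^+ #|P| * ((1 - 'X) * truncated_series P N -
    'X * \sum_(S in natural_ideals P | S != set0) t S) +
  'X * \sum_(S in natural_ideals P | S != set0) (1 - 'X) ^+ #|S|.-1 *
    ((1 - 'X) ^+ #|induced (~: S)|.+1 * t S - e S).
  have -> : \sum_(S in natural_ideals P | S != set0) (1 - 'X) ^+ #|S|.-1 *
      ((1 - 'X) ^+ #|induced (~: S)|.+1 * t S - e S) =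
    (1 - 'X) ^+ #|P| * (\sum_(S in natural_ideals P | S != set0) t S) -
    \sum_(S in natural_ideals P | S != set0) (1 - 'X) ^+ #|S|.-1 * e S.
    rewrite mulr_sumr -sumrB; apply: eq_bigr => S /andP[_ S0].
    (* The exponents add up by $(|S|-1) + (|P \setminus S|+1) = |P|$, which uses that [S] is
       nonempty. *)
    rewrite mulrBr mulrA -exprD card_induced addnS -addSn.
    by rewrite prednK ?card_gt0 // cardsC.
  by rewrite exprS; ring.
apply: dvdp_add; first by apply/dvdp_mull/truncated_series_diff.
apply: dvdp_mull; apply: (big_ind (fun p => 'X^N %| p)) => [|p q|S /andP[_ S0]].
- exact: dvdp0.
- exact: dvdp_add.
- by apply: dvdp_mull; have /is_eulerian_polyP := he S S0; apply.
Qed.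

Lemma etildeE P e : is_eulerian_poly P e -> etilde P = locfrac e #|P|.+1.
Proof.
move=> he; congr locfrac; apply: (eulerian_poly_unique _ he).
by apply: classical_sets.xgetPex; exists e.
Qed.

End Counting.

(** * Comparison of the two recursions *)

Theorem proposition3p5 (d : Order.disp_t) (P : lposet d) : psi P = etilde P.
Proof.
(* The strengthened claim makes the induction also produce the existence of the Eulerian
   polynomial. *)
suff [e he ->] : exists2 e, is_eulerian_poly P e & psi P = locfrac e #|P|.+1.
  by rewrite (etildeE he).
have [k] := ubnP #|P|; elim: k P => // k IH P; rewrite ltnS => le_Pk.
have [P0|P_gt0] := posnP #|P|.
  exists 1; first exact: is_eulerian_poly_empty.
  by rewrite P0 psi_empty.
have /choice[e he] (S : {set P}) : exists e, S != set0 ->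
    is_eulerian_poly (induced (~: S)) e /\
    psi (induced (~: S)) = locfrac e #|induced (~: S)|.+1.
  (* [choice] needs a value at [set0] as well; this dummy never enters the sums over nonempty
     [S]. *)
  have [_|S0] := eqVneq S set0; first by exists 0.
  have [|e] := IH (induced (~: S)); first exact: leq_trans (card_inducedC_lt S0) _.
  by exists e.
exists ('X * \sum_(S in natural_ideals P | S != set0) (1 - 'X) ^+ #|S|.-1 * e S).
  by apply: is_eulerian_poly_rec => // S /he[].
rewrite psi_nonempty //.
under eq_bigr => S /andP[_ S0] do rewrite (he S S0).2.
rewrite (@M_lambda_sum_locfrac _ _ e _ #|P|) => [|S /andP[_ S0]]; last exact: card_inducedC_lt.
congr (locfrac ('X * _) _); apply: eq_bigr => S /andP[_ S0].
by rewrite card_induced -(cardsC S) subnS addnK.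
Qed.
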